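(* Let $p$ be an odd prime, and let $r=1$ if $p\equiv 1 \pmod 4$ and $r=2$ if $p\equiv -1\pmod 4$. Let $E$ be any infinite set of positive odd integers which is closed under taking (positive) divisors and least common multiples. Then the infinite Paley graph $P(p^{rE})$ is isomorphic to the countable random graph $R$.
   Context: All graphs are undirected, without loops or multiple edges. Paley graphs: for a prime power $q\equiv 1\pmod 4$, the Paley graph $P(q)$ has vertex set the finite field $\mathbb{F}_q$ with $q$ elements, two vertices $x,y$ being adjacent if and only if $x-y$ is a quadratic residue (that is, a non-zero square) in $\mathbb{F}_q$. Infinite Paley graphs: let $p$, $r$ and $E$ be as in the claim, so $p^{re}\equiv 1\pmod 4$ for all $e\in E$. Regard the finite fields $\mathbb{F}_{p^{re}}$, $e\in E$, as subfields of a fixed algebraic closure of $\mathbb{F}_p$, so that $\mathbb{F}_{p^{re}}\subseteq\mathbb{F}_{p^{rf}}$ whenever $e$ divides $f$. Define the field $\mathbb{F}_{p^{rE}}:=\bigcup_{e\in E}\mathbb{F}_{p^{re}}$ (the direct limit of the fields $\mathbb{F}_{p^{re}}$ under inclusion). For $e\mid f$ in $E$, $f/e$ is odd, and $P(p^{re})$ is an induced subgraph of $P(p^{rf})$. The infinite Paley graph is the union (direct limit) $P(p^{rE}):=\bigcup_{e\in E}P(p^{re})$: its vertex set is $\mathbb{F}_{p^{rE}}$, and two vertices are adjacent if and only if they are adjacent in $P(p^{re})$ for some $e\in E$. Random graph: the countable random graph (or universal graph) $R$ of Erdős, Rényi and Rado is the countably infinite graph, unique up to isomorphism, with the following property $U$: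 given any two disjoint finite sets $A$ and $B$ of vertices, there is a vertex not in $A\cup B$ which is a neighbour of each vertex in $A$ and a non-neighbour of each vertex in $B$. An explicit model (Rado) has vertex set $\mathbb{N}=\{0,1,2,\ldots\}$, with vertices $x<y$ adjacent if and only if $2^x$ appears in the binary representation of $y$ as a sum of distinct powers of $2$. *)

(* Defs.v *)
From HB Require Import structures.
From mathcomp Require Import all_boot all_order all_algebra.
From mathcomp Require Import boolp classical_sets functions cardinality.
From mathcomp Require Import zify.

Set Implicit Arguments.
Unset Strict Implicit.
Unset Printing Implicit Defensive.

Import GRing.Theory.
Local Open Scope classical_set_scope.
Local Open Scope card_scope.
Local Open Scope ring_scope.

Record graph := Graph {
  vertex :> Type;
  adj : vertex -> vertex -> Prop;
  adj_sym : forall x y, adj x y -> adj y x;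
  adj_irr : forall x, ~ adj x x
}.

Definition graph_iso (G H : graph) : Prop :=
  exists2 f : G -> H, bijective f & forall x y : G, adj x y <-> adj (f x) (f y).

Definition property_U (G : graph) : Prop :=
  forall A B : set G, finite_set A -> finite_set B -> A `&` B = set0 ->
  exists v : G, [/\ ~ (A `|` B) v,
    forall a, A a -> adj v a & forall b, B b -> ~ adj v b].

(* These two conditions determine the graph up to isomorphism; [rado] below is
   a model of them. *)
Definition countable_random_graph (G : graph) : Prop :=
  [set: G] #= [set: nat] /\ property_U G.

(* 2 ^ x occurs in the binary expansion of y iff y %/ 2 ^ x is odd. *)
Definition rado_adj (x y : nat) : Prop :=
  (x < y)%N && odd (y %/ 2 ^ x) \/ (y < x)%N && odd (x %/ 2 ^ y).

Lemma rado_adj_sym x y : rado_adj x y -> rado_adj y x.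
Proof. by case; [right|left]. Qed.

Lemma rado_adj_irr x : ~ rado_adj x x.
Proof. by rewrite /rado_adj ltnn => -[]. Qed.

Definition rado : graph := Graph rado_adj_sym rado_adj_irr.

Lemma binary_digits (N : nat) (P : pred nat) :
  exists z, forall i, (i < N)%N -> odd (z %/ 2 ^ i) = P i.
Proof.
elim: N P => [|N IHN] P; first by exists 0.
have [z Hz] := IHN (fun i => P i.+1).
exists (P 0 + z.*2)%N => -[_|i lt_iN].
  by rewrite expn0 divn1 oddD odd_double addbF; case: (P 0).
by rewrite expnS divnMA divn2 half_bit_double Hz.
Qed.

Lemma rado_countable_random : countable_random_graph rado.
Proof.
split; first exact: card_eqxx.
move=> A B /finite_seqP[s ->] /finite_seqP[t ->] disj.
pose N := (\max_(i <- s ++ t) i).+1.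
have ltN i : i \in s ++ t -> (i < N)%N by move=> i_st; rewrite ltnS leq_bigmax_seq.
have [z Hz] := binary_digits N.+1 (fun i => (i == N) || (i \in s)).
have ltz i : i \in s ++ t -> (i < z)%N.
  move/ltN => /ltn_trans; apply.
  have := Hz N (ltnSn N); rewrite eqxx /=.
  case: (ltnP z (2 ^ N)) => [lt_z|le_z _]; first by rewrite divn_small.
  by apply: leq_trans le_z; apply: ltn_expl.
have bitz i : i \in s ++ t -> odd (z %/ 2 ^ i) = (i \in s).
  by move=> /ltN lt_iN; rewrite Hz ?ltnS 1?ltnW// (ltn_eqF lt_iN).
exists z; split => [zst|a /= sa|b /= tb].
- have : z \in s ++ t by rewrite mem_cat; apply/orP.
  by move/ltz; rewrite ltnn.
- by right; rewrite ltz ?bitz ?mem_cat ?sa.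
- have tb' : b \in s ++ t by rewrite mem_cat tb orbT.
  rewrite /rado_adj bitz // ltz //= => -[/andP[zb _]|sb].
    by have := ltn_trans zb (ltz _ tb'); rewrite ltnn.
  by have : ([set` s] `&` [set` t]) b by []; rewrite disj.
Qed.

Section Paley.
Variable K : closedFieldType.
Implicit Types (F : set K) (q : nat).

Definition subfield_of_order q F : Prop :=
  divring_closed (mem F) /\ F #= `I_q.

(* The subfield with q elements is unique when it exists; it is obtained here as
   the union of all such subfields, so as to be total in q. *)
Definition GF q : set K :=
  \bigcup_(F in [set F : set K | subfield_of_order q F]) F.

Definition paley_adj q (x y : K) : Prop :=
  [/\ GF q x, GF q y & exists2 z, GF q z /\ z != 0 & x - y = z ^+ 2].

Lemma subfield_seq q F : subfield_of_order q F ->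
  exists s : seq K, [/\ uniq s, size s = q & forall x, F x <-> x \in s].
Proof.
case=> _ Fq; have /finite_seqP[t tF] : finite_set F by exists q.
have tP x : F x <-> x \in undup t by rewrite mem_undup tF.
exists (undup t); split=> //; first exact: undup_uniq.
have /card_set_bijP[f [fF finj fsurj]] := Fq.
rewrite -(size_map f) -(size_iota 0 q); apply: perm_size.
apply: uniq_perm; rewrite ?iota_uniq ?map_inj_in_uniq ?undup_uniq //.
  by move=> x y /tP Fx /tP Fy; apply: finj; apply/mem_set.
move=> n; rewrite mem_iota; apply/mapP/idP => [[x /tP/fF nq ->]|/fsurj[x Fx <-]] //.
by exists x; first exact/tP.
Qed.

Lemma subfield_root q F y : subfield_of_order q F ->
  (0 < q)%N -> y ^+ q = y -> F y.
Proof.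
move=> Fq q_gt0 yq; have [s [s_uniq s_size sP]] := subfield_seq Fq.
have [[F1 FB FD] _] := Fq.
have F0 : 0 \in F by rewrite -(subrr (1 : K)) FB.
have s0 : 0 \in s by apply/sP/set_mem.
have q_gt1 : (1 < q)%N.
  rewrite -s_size; apply: (@uniq_leq_size _ [:: 0; 1]).
    by rewrite /= inE eq_sym oner_eq0.
  by move=> x; rewrite !inE => /orP[]/eqP->//; apply/sP/set_mem.
have FM x z : x \in F -> z \in F -> x * z \in F.
  move=> Fx Fz; rewrite -[z]invrK; apply: (FD) => //.
  by rewrite -[z^-1]mul1r; apply: FD.
pose s' := rem 0 s.
have s'E x : (x \in s') = (x != 0) && (x \in s) by rewrite mem_rem_uniq.
have s'q : size s' = q.-1 by rewrite size_rem ?s_size.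
have roots x : x \in s -> x ^+ q = x.
  move=> sx; have [->|x0] := eqVneq x 0; first by rewrite expr0n; case: (q) q_gt0.
  have s'_uniq : uniq s' by apply: rem_uniq.
  have xs_uniq : uniq (map ( *%R x) s') by rewrite map_inj_uniq //; apply: mulfI.
  have sub : {subset map ( *%R x) s' <= s'}.
    move=> _ /mapP[z s'z ->]; move: s'z; rewrite !s'E => /andP[z0 sz].
    rewrite mulf_neq0 //=; apply/sP/set_mem/FM; exact/mem_set/sP.
  have [_ eqs] := uniq_min_size xs_uniq sub (eq_leq (esym (size_map _ _))).
  have eq_prod : \prod_(z <- map ( *%R x) s') z = \prod_(z <- s') z.
    exact/perm_big/uniq_perm.
  move: eq_prod.
  rewrite big_map big_split /= big_const_seq count_predT s'q iter_mulr_1.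
  have nz : \prod_(i <- s') i != 0.
    by rewrite prodf_seq_neq0; apply/allP => z; rewrite s'E => /andP[].
  rewrite -[RHS]mul1r => /(mulIf nz) xq1.
  by rewrite -(prednK q_gt0) exprS xq1 mulr1.
apply/sP; apply/negPn/negP => ys.
pose P : {poly K} := 'X^q - 'X.
have szP : size P = q.+1.
  by rewrite size_polyDl ?size_polyXn // size_polyN size_polyX ltnS.
have P0 : P != 0 by rewrite -size_poly_eq0 szP.
have : (size (y :: s) < size P)%N.
  apply: max_poly_roots => //; last by rewrite /= ys.
  apply/allP => x; rewrite inE /root !hornerE subr_eq0.
  by case/orP=> [/eqP->|/roots->//]; apply/eqP.
by rewrite szP /= s_size ltnn.
Qed.

Lemma paley_adj_sym q x y : q = 1 %[mod 4] -> paley_adj q x y -> paley_adj q y x.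
Proof.
move=> q1 [Gx Gy [z [[F Fq Fz] z0] xyz]]; split=> //.
have /closed_rootP[i] : size ('X^2 + 1 : {poly K}) != 1%N.
  by rewrite size_polyDl ?size_polyXn ?size_poly1.
rewrite /root !hornerE addr_eq0 => /eqP i2.
have iq : i ^+ q = i.
  rewrite (divn_eq q 4) q1 exprD mulnC exprM (_ : i ^+ 4 = 1) ?expr1n ?mul1r //.
  by rewrite (exprM i 2 2) i2 sqrrN expr1n.
have q_gt0 : (0 < q)%N by case: (q) q1.
have Fi := subfield_root Fq q_gt0 iq.
have [[F1 FB FD] _] := Fq.
have i0 : i != 0.
  by apply: contra_eq_neq i2 => ->; rewrite expr0n eq_sym oppr_eq0 oner_neq0.
exists (z / i); first split.
- by exists F => //; apply/set_mem/FD; apply/mem_set.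
- by rewrite mulf_neq0 ?invr_neq0.
- by rewrite expr_div_n i2 -xyz invrN1 mulrN1 opprB.
Qed.

Lemma paley_adj_irr q x : ~ paley_adj q x x.
Proof.
by case=> _ _ [z [_ z0]] /eqP; rewrite subrr eq_sym sqrf_eq0 (negPf z0).
Qed.

End Paley.

Arguments GF : clear implicits.

Definition paley_r (p : nat) : nat := if p == 1 %[mod 4] then 1%N else 2%N.

Lemma paley_order_mod4 p e : odd p -> (p ^ (paley_r p * e) = 1 %[mod 4])%N.
Proof.
move=> p_odd; rewrite expnM -modnXm /paley_r.
have [p1|p1] := eqP; first by rewrite expn1 p1 exp1n.
have -> : (p ^ 2 = 1 %[mod 4])%N; last by rewrite exp1n.
have p3 : (p %% 4 = 3)%N by lia.
by rewrite -modnXm p3.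
Qed.

Definition GF_union (K : closedFieldType) (p r : nat) (E : set nat) : set K :=
  \bigcup_(e in E) GF K (p ^ (r * e)).

Arguments GF_union : clear implicits.

Section InfinitePaley.
Variables (K : closedFieldType) (p : nat) (p_odd : odd p) (E : set nat).

Definition infinite_paley_adj (x y : set_type (GF_union K p (paley_r p) E)) : Prop :=
  exists2 e, E e & paley_adj (p ^ (paley_r p * e)) (sval x) (sval y).

Lemma infinite_paley_adj_sym x y :
  infinite_paley_adj x y -> infinite_paley_adj y x.
Proof.
by case=> e Ee xy; exists e => //; apply/paley_adj_sym/xy/paley_order_mod4.
Qed.

Lemma infinite_paley_adj_irr x : ~ infinite_paley_adj x x.
Proof. by case=> e _ /paley_adj_irr. Qed.

Definition infinite_paley : graph :=
  Graph infinite_paley_adj_sym infinite_paley_adj_irr.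

End InfinitePaley.

(* Main.v *)
(* For a finite set S of vertices, property U asks for v in a large finite
   subfield such that the v - a, for a in S, have prescribed quadratic
   characters. Expanding the indicator of such v into characters reduces this to
   showing, for each nonempty T in S and f the product of the X - a for a in T,
   that the character of f is equidistributed over F_q when q is large. This
   comes from Bombieri's version of Stepanov's method: write q = P Q with P a
   fixed, large power of the characteristic. Linear algebra gives a nonzero
   combination W of the X^(i + j Q) f^(b (Q + 1) / 2), with b = 0 or 1, whose
   P-th power vanishes at each v in F_q with f(v) a nonzero square, because
   v^(P Q) = v. Hence there are at most deg W <= q / 2 + O(Q) such v. The same
   bound for multiples of f handles nonsquares, and the O(Q) is small compared
   with q since P is large. Finally, countable graphs with property U are
   isomorphic by back-and-forth. *)
Require Import Defs.
From mathcomp Require Import all_boot all_order all_algebra all_field.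
From mathcomp Require Import boolp classical_sets functions cardinality.
From mathcomp Require Import zify ring.

Set Implicit Arguments.
Unset Strict Implicit.
Unset Printing Implicit Defensive.

Import Order.TTheory GRing.Theory Num.Theory.
Local Open Scope classical_set_scope.
Local Open Scope card_scope.
Local Open Scope ring_scope.

(** * Arithmetic of halves and linear dependence of polynomials *)

Lemma uphalf_mul_odd (P Q : nat) :
  odd P -> odd Q -> (Q.+1./2 * P = (P * Q)./2 + P.+1./2)%N.
Proof.
move=> Podd Qodd.
have [[s ->] [t ->]] : (exists s, P = s.*2.+1) /\ (exists t, Q = t.*2.+1).
  by split; [exists P./2|exists Q./2]; lia.
have -> : (s.*2.+1 * t.*2.+1 = (s * t.*2 + s + t).*2.+1)%N by lia.
by rewrite -!doubleS !doubleK -[in RHS]uphalfE uphalf_double; lia.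
Qed.

(** The matrix of coefficients has more rows than columns, so its left kernel contains a nonzero
    vector. *)
Lemma poly_family_dependent (F : fieldType) (I : finType) (g : I -> {poly F}) e :
  (forall i, size (g i) <= e)%N -> (e < #|I|)%N ->
  exists2 c : I -> F, exists i, c i != 0 & \sum_i c i *: g i = 0.
Proof.
move=> size_g lt_eI.
pose M := \matrix_(k < #|I|, l < e) (g (enum_val k))`_l.
have : kermx M != 0.
  rewrite -mxrank_eq0 mxrank_ker subn_eq0 -ltnNge.
  exact: leq_ltn_trans (rank_leq_col _) lt_eI.
case/rowV0Pn => v /sub_kermxP vM v0.
exists (fun i => v 0 (enum_rank i)).
  have [k vk] : exists k, v 0 k != 0.
    apply/existsP; rewrite -negb_forall; apply: contra v0 => /forallP v0.
    by apply/eqP/rowP => k; rewrite mxE; apply/eqP.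
  by exists (enum_val k); rewrite enum_valK.
apply/polyP => l; rewrite coef0 coef_sum.
have [lt_le|le_el] := ltnP l e; last first.
  rewrite big1 // => i _; rewrite coefZ nth_default ?mulr0 //.
  exact: leq_trans (size_g i) le_el.
have := congr1 (fun w : 'rV_e => w 0 (Ordinal lt_le)) vM.
rewrite !mxE => vM_l; rewrite -[RHS]vM_l (reindex (@enum_val _ I)) /=; last first.
  by apply: onW_bij; apply: enum_val_bij.
by apply: eq_bigr => k _; rewrite coefZ enum_valK mxE.
Qed.

(** * Stepanov's method for the points where a polynomial takes square values *)

Section AuxiliaryPolynomial.
Variable K : closedFieldType.
Implicit Types (f g a b : {poly K}) (x : K).

(** Multiplicities at [x] decide: [x] is a simple root of [f], so unless both sides vanish its
    multiplicity is even on the left and odd on the right. *)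
Lemma sqr_eq_odd_mul f g a b x c : f = ('X - x%:P) * g -> ~~ root g x -> c != 0 ->
  a ^+ 2 = c *: (f * b ^+ 2) -> a = 0 /\ b = 0.
Proof.
move=> -> gx c0 ab.
have g0 : g != 0 by apply: contra gx => /eqP->; rewrite root0.
have [b0|b0] := eqVneq b 0.
  by split=> //; move/eqP: ab; rewrite b0 expr0n mulr0 scaler0 sqrf_eq0 => /eqP.
have X0 : 'X - x%:P != 0 by rewrite polyXsubC_eq0.
have a0 : a != 0.
  apply: contra_eq_neq ab => ->; rewrite expr0n eq_sym scaler_eq0 negb_or c0 /=.
  by rewrite !mulf_neq0 // expf_neq0.
have := congr1 (mup x) ab.
rewrite -mul_polyC !expr2 !mupM ?mulf_neq0 ?expf_neq0 ?polyC_eq0 //.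
rewrite (mupNroot gx) -['X - _]expr1 mup_XsubCX eqxx.
by rewrite (mupNroot (_ : ~~ root c%:P x)) ?rootC //; lia.
Qed.

(** The [u j] act as digits in base X^Q: reduction modulo X^Q kills [u 0], and after division by X^Q
    the argument repeats. *)
Lemma sum_XnM_eq0 Q n (u : nat -> {poly K}) :
  (forall j, 'X^Q %| u j -> u j = 0) ->
  \sum_(j < n) 'X^(j * Q) * u j = 0 -> forall j, (j < n)%N -> u j = 0.
Proof.
elim: n u => // n IHn u u0 sum0.
have X0 : 'X^Q != 0 :> {poly K} by rewrite monic_neq0 ?monicXn.
have sumE : \sum_(i < n.+1) 'X^(i * Q) * u i =
            u 0 + 'X^Q * \sum_(i < n) 'X^(i * Q) * u i.+1.
  rewrite big_ord_recl mul0n expr0 mul1r; congr (_ + _).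
  by rewrite big_distrr; apply: eq_bigr => i _; rewrite /= mulrA -exprD.
move: sum0; rewrite sumE => sum0.
have u00 : u 0 = 0.
  apply: u0; have := dvdp0 ('X^Q : {poly K}).
  by rewrite -sum0 dvdp_addl // dvdp_mulr.
move: sum0; rewrite u00 add0r => /eqP; rewrite mulf_eq0 (negPf X0) /= => /eqP sum0.
by case=> [|j] // jn; apply: (IHn (fun j => u j.+1)) => // i; apply: u0.
Qed.

Variables (p : nat) (charK : p \in [pchar K]).
Let p_prime : prime p := pcharf_prime charK.

Lemma pchar_natX i : [pchar K].-nat (p ^ i)%N.
Proof. by rewrite pnatX (eq_pnat _ (pcharf_eq charK)) pnat_id. Qed.

Lemma pchar_poly_natX i : [pchar {poly K}].-nat (p ^ i)%N.
Proof. by rewrite (eq_pnat _ (pchar_poly _)) pchar_natX. Qed.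

Lemma sum_exp_pchar (I : finType) (F : I -> K) i :
  (\sum_x F x) ^+ (p ^ i) = \sum_x F x ^+ (p ^ i).
Proof.
apply: (big_morph (fun x => x ^+ (p ^ i))).
  by move=> x y; rewrite exprDn_pchar // pchar_natX.
by rewrite expr0n expn_eq0; case: (p) p_prime.
Qed.

Lemma exprB_pchar (x y : K) i : (x - y) ^+ (p ^ i) = x ^+ (p ^ i) - y ^+ (p ^ i).
Proof.
apply/eqP; rewrite eq_sym subr_eq -exprDn_pchar ?pchar_natX //.
by rewrite subrK.
Qed.

Hypothesis p_odd : odd p.

(* Squaring removes the root f^((Q + 1)/2), and f^Q is the constant f(0)^Q
   modulo X^Q. *)
Lemma dvdp_Xn_eq0 i m f g a b x A (Q := (p ^ i)%N) :
  f = ('X - x%:P) * g -> ~~ root g x -> f.[0] != 0 ->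
  (size f <= m.+1)%N -> (2 * A + m < Q)%N ->
  (size a <= A.+1)%N -> (size b <= A.+1)%N ->
  'X^Q %| a + f ^+ Q.+1./2 * b -> a = 0 /\ b = 0.
Proof.
move=> fE gx f0 szf ltQ sza szb dvd.
have Qodd : odd Q by rewrite oddX p_odd orbT.
have fQ : 'X^Q %| f ^+ Q - (f.[0] ^+ Q)%:P.
  have /factor_theorem[h] : root (f - f.[0]%:P) 0 by rewrite /root !hornerE subrr.
  rewrite subr0 => /eqP; rewrite subr_eq => /eqP fX.
  rewrite {1}fX exprDn_pchar ?pchar_poly_natX // exprMn_comm; last exact: mulrC.
  by rewrite -rmorphXn /= addrK dvdp_mull.
have {}dvd : 'X^Q %| a ^+ 2 - f.[0] ^+ Q *: (f * b ^+ 2).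
  have -> : a ^+ 2 - f.[0] ^+ Q *: (f * b ^+ 2) =
    (a - f ^+ Q.+1./2 * b) * (a + f ^+ Q.+1./2 * b) +
    (f ^+ Q - (f.[0] ^+ Q)%:P) * (f * b ^+ 2).
    rewrite -subr_sqr [(_ * b) ^+ 2]exprMn_comm; last exact: mulrC.
    rewrite -exprM (_ : Q.+1./2 * 2 = Q.+1)%N; last by lia.
    by rewrite [f ^+ Q.+1]exprS -mul_polyC; ring.
  by apply: dvdp_add; [apply: dvdp_mull|apply: dvdp_mulr].
apply: (sqr_eq_odd_mul fE gx (expf_neq0 Q f0)).
(* The difference has degree at most 2A + m < Q, so a multiple of X^Q of this form is zero. *)
apply/eqP; rewrite -subr_eq0; apply: contraTT ltQ => nz.
rewrite -leqNgt -ltnS; have := dvdp_leq nz dvd; rewrite size_polyXn => /leq_trans; apply.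
have sz2 (d : {poly K}) : (size d <= A.+1)%N -> (size (d ^+ 2) <= (2 * A).+1)%N.
  by move=> szd; have := size_poly_exp_leq d 2; lia.
apply: leq_trans (size_polyD _ _) _; rewrite size_polyN geq_max.
rewrite (leq_trans (sz2 _ sza)) ?ltnS ?leq_addr //=.
apply: leq_trans (size_scale_leq _ _) _; apply: leq_trans (size_polyMleq _ _) _.
by have := sz2 _ szb; lia.
Qed.

(** The bound on [size V] is the degree bound for W. The lower bound on [A] provides enough
    coefficients for the linear relation to exist, and the upper bound keeps W from vanishing. *)
Lemma square_values_bound_coef0 i k m f g x (V : seq K) A
    (P := (p ^ i)%N) (Q := (p ^ k)%N) :
  f = ('X - x%:P) * g -> ~~ root g x -> f.[0] != 0 ->
  (size f <= m.+1)%N -> (m * P.+1./2 <= A)%N -> (2 * A + m < Q)%N -> uniq V ->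
  (forall v, v \in V -> v ^+ (P * Q) = v /\ f.[v] ^+ (P * Q)./2 = 1) ->
  (size V <= A + P./2 * Q + m * Q.+1./2)%N.
Proof.
move=> fE gx f0 szf leA ltQ uV VE.
have Podd : odd P by rewrite oddX p_odd orbT.
have Qodd : odd Q by rewrite oddX p_odd orbT.
pose I := ('I_P.+1./2 * ('I_A.+1 * bool))%type.
(* The relation is between the G P 1 ((P + 1)/2), and its P-th root W is a
   combination of the G 1 Q ((Q + 1)/2): the two agree at each v in V, as
   v^(P Q) = v and f(v)^((P Q - 1)/2) = 1. *)
pose G (s t h : nat) (y : I) : {poly K} := 'X^(y.2.1 * s + y.1 * t) * f ^+ (y.2.2 * h).
have szG s t h y : (size (G s t h y) <= (A * s + P./2 * t + m * h).+1)%N.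
  apply: leq_trans (size_polyMleq _ _) _; rewrite size_polyXn addSn /=.
  have le_bh : ((size f).-1 * (y.2.2 * h) <= m * h)%N.
    by apply: leq_mul; [lia|case: y.2.2; lia].
  have le_is : (y.2.1 * s <= A * s)%N by rewrite leq_mul2r -ltnS ltn_ord orbT.
  have le_jt : (y.1 * t <= P./2 * t)%N.
    by rewrite leq_mul2r; apply/orP; right; have := ltn_ord y.1; lia.
  rewrite -addnS !leq_add //; apply: leq_trans (size_poly_exp_leq _ _) _.
  by rewrite ltnS.
(* There are (P + 1)(A + 1) unknowns against AP + (P - 1)/2 + m(P + 1)/2 + 1 coefficients, and m(P +
   1)/2 is at most A. *)
have [|c [y0 c0] sum0] := poly_family_dependent (szG P 1%N P.+1./2).
  have [j jE PE] : exists2 j, P./2 = j & P = j.*2.+1 by exists P./2; lia.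
  have -> : P.+1./2 = j.+1 by lia.
  have leA' : (m * j.+1 <= A)%N by apply: leq_trans leA; rewrite leq_mul2l; lia.
  by rewrite !card_prod !card_ord card_bool jE PE; lia.
have P_gt0 : (0 < P)%N by rewrite expn_gt0 prime_gt0.
have /fin_all_exists[d dP] y : exists z, z ^+ P = c y.
  have /closed_rootP[z] : size ('X^P - (c y)%:P) != 1 by rewrite size_XnsubC //; lia.
  by rewrite /root !hornerE subr_eq0 => /eqP; exists z.
pose W := \sum_y d y *: G 1%N Q Q.+1./2 y.
have szW : (size W <= (A + P./2 * Q + m * Q.+1./2).+1)%N.
  rewrite -[A]muln1; apply: leq_trans (size_sum _ _ _) _; apply/bigmax_leqP => y _.
  exact: leq_trans (size_scale_leq _ _) (szG _ _ _ _).
suff W0 : W != 0.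
  rewrite -ltnS; apply: leq_trans szW; apply: max_poly_roots => //.
  apply/allP => v /VE[vq fv]; rewrite /root -[_ == 0]andTb -P_gt0 -expf_eq0.
  rewrite horner_sum sum_exp_pchar; apply/eqP.
  transitivity ((\sum_y c y *: G P 1%N P.+1./2 y).[v]); last by rewrite sum0 horner0.
  rewrite horner_sum; apply: eq_bigr => y _; rewrite !hornerZ -/P exprMn dP; congr (_ * _).
  rewrite !hornerM !horner_exp !hornerX exprMn -!exprM; congr (_ * _).
    rewrite mulnDl !muln1 -mulnA [(Q * P)%N]mulnC [(_ * (P * Q))%N]mulnC.
    by rewrite !exprD [v ^+ (P * Q * _)]exprM vq.
  case: y.2.2; rewrite ?mul0n // !mul1n.
  by rewrite uphalf_mul_odd // exprD fv mul1r.
(* If W = 0, collecting the terms by X^(jQ) leaves digits [u false j + f ^+ Q.+1./2 * u true j], to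
   which [dvdp_Xn_eq0] and [sum_XnM_eq0] apply. All [d y] then vanish, hence all [c y]. *)
apply: contraNneq c0 => W0.
(* The default 0 outside the range of [j] makes [u] a family indexed by [nat], as [sum_XnM_eq0]
   requires. *)
pose u (b : bool) (j : nat) := \poly_(l < A.+1)
  (if (insub j : option 'I_P.+1./2) is Some j' then d (j', (inord l, b)) else 0).
have uE (j : 'I_P.+1./2) (b : bool) : u b j = \sum_(l < A.+1) d (j, (l, b)) *: 'X^l.
  by rewrite /u poly_def; apply: eq_bigr => l _; rewrite valK inord_val.
have u0 (b : bool) j : (j < P.+1./2)%N -> u b j = 0.
  move=> lt_j; pose w j := u false j + f ^+ Q.+1./2 * u true j.
  have szu (b' : bool) j' : (size (u b' j') <= A.+1)%N by apply: size_poly.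
  have key j' : 'X^Q %| w j' -> u false j' = 0 /\ u true j' = 0.
    by apply: dvdp_Xn_eq0 fE gx f0 szf ltQ _ _.
  have w0 : w j = 0.
    apply: (@sum_XnM_eq0 Q P.+1./2 w) lt_j.
      by move=> j' /key[uf ut]; rewrite /w uf ut mulr0 addr0.
    have sum2 (I1 I2 : finType) (F : I1 * I2 -> {poly K}) :
        \sum_y F y = \sum_y1 \sum_y2 F (y1, y2).
      by rewrite pair_bigA; apply: eq_bigr => -[].
    rewrite -[RHS]W0 /W sum2; apply: eq_bigr => j' _; rewrite sum2.
    rewrite /w !uE !mulr_sumr -big_split mulr_sumr; apply: eq_bigr => l _ /=.
    rewrite big_bool /G /= mul1n mul0n expr0 mulr1 muln1 exprD -!mul_polyC; ring.
  by have [uf ut] := key j (eq_ind_r (fun h => 'X^Q %| h) (dvdp0 _) w0); case: b.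
move: y0 => [j [l b]]; rewrite -dP.
have := congr1 (fun h : {poly K} => h`_l) (u0 b j (ltn_ord j)).
by rewrite /u coef_poly ltn_ord coef0 valK inord_val => ->; rewrite expr0n; case: (P) P_gt0.
Qed.

Lemma square_values_bound i k m f g x (V : seq K) A
    (P := (p ^ i)%N) (Q := (p ^ k)%N) :
  f = ('X - x%:P) * g -> ~~ root g x ->
  (size f <= m.+1)%N -> (m * P.+1./2 <= A)%N -> (2 * A + m < Q)%N -> uniq V ->
  (forall v, v \in V -> v ^+ (P * Q) = v /\ f.[v] ^+ (P * Q)./2 = 1) ->
  (size V <= A + P./2 * Q + m * Q.+1./2)%N.
Proof.
case: V => [|t V'] // fE gx szf leA ltQ uV VE; set V := t :: V' in uV VE *.
have [tq ft] := VE t (mem_head _ _).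
(* Translating by an element of V ensures f(0) <> 0. *)
pose T : {poly K} := 'X + t%:P.
(* With a positive exponent, f(t)^((PQ - 1)/2) = 1 forces f(t) to be nonzero. *)
have PQ1 : (0 < (P * Q)./2)%N.
  have [Podd Qodd] : odd P /\ odd Q by rewrite !oddX p_odd !orbT.
  have g0 : g != 0 by apply: contra gx => /eqP->; rewrite root0.
  have : (1 < size f)%N by rewrite fE size_monicM ?monicXsubC // size_XsubC ltnS size_poly_gt0.
  have : (0 < P)%N by rewrite expn_gt0 prime_gt0.
  nia.
rewrite -(size_map (fun v => v - t)).
apply: (@square_values_bound_coef0 i k m (f \Po T) (g \Po T) (x - t)) => //.
- rewrite fE rmorphM rmorphB /= comp_polyX comp_polyC /T polyCB; congr (_ * _); ring.
- by rewrite /root horner_comp !hornerE subrK.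
- rewrite horner_comp !hornerE; apply: contra_eq_neq ft => ->.
  by rewrite expr0n gtn_eqF // eq_sym oner_eq0.
- by rewrite size_comp_poly2 // size_XaddC.
- by rewrite map_inj_uniq //; apply: addIr.
move=> _ /mapP[v /VE[vq fv] ->]; rewrite horner_comp !hornerE subrK; split=> //.
by rewrite -expnD exprB_pchar expnD vq tq.
Qed.

(** * Finite subfields, character sums and prescribed quadratic characters *)

Lemma frobenius_fixed_points n : (0 < n)%N ->
  exists V : seq K, [/\ uniq V, size V = (p ^ n)%N &
    forall x, (x \in V) = (x ^+ (p ^ n) == x)].
Proof.
move=> n_gt0; pose h : {poly K} := 'X^(p ^ n) - 'X.
have pn_gt1 : (1 < p ^ n)%N by rewrite -(exp1n n) ltn_exp2r // prime_gt1.
have szh : size h = (p ^ n).+1.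
  by rewrite size_polyDl ?size_polyXn // size_polyN size_polyX ltnS.
have lead_h : lead_coef h = 1.
  by rewrite lead_coefDl ?lead_coefXn // size_polyXn size_polyN size_polyX ltnS.
have [V hE] := closed_field_poly_normal h; rewrite lead_h scale1r in hE.
exists V; split.
(* The derivative of X^(p^n) - X is -1, so the roots are distinct. *)
- rewrite -separable_prod_XsubC -hE separable_poly.unlock derivB derivXn derivX.
  have -> : 'X^((p ^ n).-1) *+ (p ^ n) = 0 :> {poly K}.
    by rewrite -mulr_natr natrX pcharf0 ?pchar_poly // expr0n gtn_eqF // mulr0.
  by rewrite sub0r -scaleN1r coprimepZr ?oppr_eq0 ?oner_eq0 // coprimep1.
- by apply: succn_inj; rewrite -szh hE size_prod_XsubC.
- by move=> x; rewrite -root_prod_XsubC -hE /root !hornerE subr_eq0.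
Qed.

(** If the values 1 and -1 are taken n and n' times, then |n - n'| = 2 max(n, n') - (n + n'). *)
Lemma sum_sign_bound (T : eqType) (D : seq T) (F : T -> int) (b : nat) :
  (forall v, v \in D -> F v = 1 \/ F v = -1) ->
  (count (fun v => F v == 1%R) D <= b)%N -> (count (fun v => F v == -1%R) D <= b)%N ->
  `|\sum_(v <- D) F v| <= (2 * b)%:Z - (size D)%:Z.
Proof.
move=> F1 le1 leN1.
suff [-> ->] : \sum_(v <- D) F v =
    (count (fun v => F v == 1%R) D)%:Z - (count (fun v => F v == -1%R) D)%:Z /\
    size D = (count (fun v => F v == 1%R) D + count (fun v => F v == -1%R) D)%N.
  by rewrite ler_norml; lia.
elim: D F1 {le1 leN1} => [|v D IHD] F1; first by rewrite big_nil.
have [|sumE sizeE] := IHD; first by move=> w wD; apply: F1; rewrite inE wD orbT.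
by rewrite big_cons sumE /= sizeE; have [->|->] := F1 v (mem_head _ _); split; lia.
Qed.

(** The lower bound on P absorbs the error terms proportional to Q, and the lower bound on Q absorbs
    the remaining ones, which involve only m and P. *)
Lemma sign_pattern m i k (S : m.-tuple K) (eps : 'I_m -> bool)
    (P := (p ^ i)%N) (Q := (p ^ k)%N) :
  (0 < k)%N -> uniq S -> (forall l, tnth S l ^+ (P * Q) = tnth S l) ->
  (2 ^ m * m < P)%N -> (2 ^ m * (m * P + 3 * m) < Q)%N ->
  exists v, [/\ v ^+ (P * Q) = v, v \notin S &
    forall l, (v - tnth S l) ^+ (P * Q)./2 = (-1) ^+ eps l].
Proof.
move=> k_gt0 uS Sq ltP ltQ.
have [Podd Qodd] : odd P /\ odd Q by rewrite !oddX p_odd !orbT.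
have P_gt0 : (0 < P)%N by case: (P) Podd.
have Q_gt1 : (1 < Q)%N by rewrite -(exp1n k) ltn_exp2r // prime_gt1.
have PQ_gt1 : (1 < P * Q)%N by rewrite (leq_trans Q_gt1) // leq_pmull.
pose h := (P * Q)./2.
have hE : (P * Q = h * 2 + 1)%N.
  by rewrite -[LHS]odd_double_half oddM Podd Qodd addnC -muln2.
have h_gt0 : (0 < h)%N by lia.
have [|V [uV szV VE]] := @frobenius_fixed_points (i + k); first by rewrite addn_gt0 k_gt0 orbT.
rewrite expnD -/P -/Q in szV VE.
pose D := [seq v <- V | v \notin S].
have uD : uniq D by rewrite filter_uniq.
have DE v : v \in D -> v ^+ (P * Q) = v /\ v \notin S.
  by rewrite mem_filter VE => /andP[vS /eqP].
have szD : (P * Q <= size D + m)%N.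
  rewrite -szV -(count_predC (mem S) V) addnC size_filter leq_add2l -size_filter.
  rewrite (leq_trans _ (eq_leq (size_tuple S))) // uniq_leq_size ?filter_uniq // => v.
  by rewrite mem_filter => /andP[].
(* The quadratic character is lifted to the integers, where sums can be estimated by absolute
   values. On [D] the differences are nonzero, so Euler's criterion applies. *)
pose chi l v : int := (-1) ^+ ((v - tnth S l) ^+ h != 1).
have chiE l v : v \in D -> (chi l v)%:~R = (v - tnth S l) ^+ h.
  move=> /DE[vq vS]; rewrite /chi rmorphXn rmorphN rmorph1.
  have va0 : v - tnth S l != 0.
    by rewrite subr_eq0; apply: contraNneq vS => ->; apply: mem_tnth.
  have : ((v - tnth S l) ^+ h) ^+ 2 == 1.
    rewrite -exprM -(inj_eq (mulIf va0)) -exprSr -addn1 -hE mul1r.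
    by rewrite -expnD exprB_pchar expnD vq Sq.
  rewrite sqrf_eq1 => /orP[] /eqP->; first by rewrite eqxx.
  by have [->|_] := eqVneq (-1 : K) 1.
have [/hasP[v vD /forallP ok]|/hasPn none] :=
    boolP (has (fun v => [forall l, chi l v == (-1) ^+ eps l]) D).
  exists v; have [vq vS] := DE v vD; split=> // l.
  by rewrite -/h -chiE // (eqP (ok l)) rmorphXn rmorphN rmorph1.
pose F (J : {set 'I_m}) v : int := \prod_l (if l \in J then (-1) ^+ eps l * chi l v else 1).
(* For fixed [v] the sum over J is the product over l of 1 + (-1)^(eps l) chi_l(v). A place where
   [v] misses the pattern contributes a factor 0. *)
have sum0 : \sum_J \sum_(v <- D) F J v = 0.
  rewrite exchange_big big_seq big1 //= => v /none /forallPn[l chi_l].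
  rewrite -bigA_distr (bigD1 l) //= [X in X * _](_ : _ = 0) ?mul0r //.
  by move: chi_l; rewrite /chi; case: (eps l) (_ != 1) => -[].
pose A := (m * P.+1./2)%N.
pose b := (A + P./2 * Q + m * Q.+1./2)%N.
have bound J : J != finset.set0 -> `|\sum_(v <- D) F J v| <= (2 * b)%:Z - (size D)%:Z.
  case/set0Pn => l0 Jl0.
  pose e : K := \prod_(l in J) (-1) ^+ eps l.
  have e2 : e ^+ 2 = 1.
    by rewrite -prodrXl big1 // => l _; rewrite sqrr_sign.
  pose f := \prod_(l in J) ('X - (tnth S l)%:P).
  have FE v : v \in D -> (F J v)%:~R = e * f.[v] ^+ h.
    move=> vD; rewrite /F -big_mkcond rmorph_prod horner_prod -prodrXl -big_split /=.
    apply: eq_bigr => l _; rewrite rmorphM /= chiE // rmorphXn rmorphN rmorph1.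
    by rewrite !hornerE.
  have F1 v : F J v = 1 \/ F J v = -1.
    have : F J v ^+ 2 == 1.
      rewrite -prodrXl big1 // => l _; case: ifP => _; last exact: expr1n.
      by rewrite exprMn !sqrr_sign mulr1.
    by rewrite sqrf_eq1 => /orP[]/eqP->; [left|right].
  have count_le (s : int) : s ^+ 2 = 1 -> (count (fun v => F J v == s) D <= b)%N.
    (* On [D], [F J v] is e f(v)^h. Scaling f by c with c^h = s e turns the level set of s into
       points where (c f)^h = 1, so one bound serves both signs. *)
    move=> s2; have [c cE] : exists c : K, c ^+ h = s%:~R * e.
      have /closed_rootP[c] : size ('X^h - (s%:~R * e)%:P) != 1 by rewrite size_XnsubC //; lia.
      by rewrite /root !hornerE subr_eq0 => /eqP; exists c.
    have c0 : c != 0.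
      apply: contra_eq_neq cE => ->; rewrite expr0n gtn_eqF // eq_sym.
      rewrite -sqrf_eq0 exprMn e2 -rmorphXn s2 /= mulr1 oner_eq0 //.
    rewrite -size_filter.
    apply: (@square_values_bound i k m (c *: f)
      (c *: \prod_(l in J | l != l0) ('X - (tnth S l)%:P)) (tnth S l0)) => //.
    - by rewrite /f (bigD1 l0) //= scalerAr.
    - rewrite rootZ // /root horner_prod; apply/prodf_neq0 => l /andP[_ ll0].
      rewrite !hornerE subr_eq0 eq_sym.
      by rewrite (inj_eq (tuple_uniqP _ uS)).
    - rewrite size_scale // /f -big_enum size_prod_XsubC ltnS -cardE.
      by rewrite (leq_trans (max_card _)) ?card_ord.
    - have : (2 ^ m * (m * P + 3 * m) >= m * P + 3 * m)%N by rewrite leq_pmull ?expn_gt0.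
      have : (2 * A <= m * P.+1)%N by rewrite /A mulnCA leq_mul2l; apply/orP; right; lia.
      by move: ltQ; rewrite mulnS; lia.
    - by rewrite filter_uniq.
    move=> v; rewrite mem_filter => /andP[/eqP Fs vD]; have [vq _] := DE v vD.
    split=> //; rewrite hornerZ exprMn -/h cE -mulrA -FE // Fs -rmorphM -expr2 s2.
    by rewrite rmorph1.
  by apply: sum_sign_bound => [v _||]; [apply: F1|apply: count_le..]; rewrite ?sqrrN expr1n.
(* The empty set contributes |D|, which the other 2^m - 1 sets must cancel. *)
have : (size D)%:Z <= (2 ^ m - 1)%:Z * ((2 * b)%:Z - (size D)%:Z).
  have F0 : \sum_(v <- D) F finset.set0 v = (size D)%:Z.
    rewrite (eq_bigr (fun=> 1)) => [|v _]; last by rewrite /F big1 // => l; rewrite inE.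
    by rewrite big_const_seq count_predT iter_addr_0 natz.
  move: sum0; rewrite (bigD1 finset.set0) //= F0 => /eqP; rewrite addr_eq0 => /eqP sizeE.
  rewrite [leLHS]sizeE; apply: le_trans (ler_norm _) _; rewrite normrN.
  apply: le_trans (ler_norm_sum _ _ _) _; apply: le_trans (ler_sum _ bound) _.
  rewrite sumr_const cardC1 -cardsT -powersetT card_powerset cardsT card_ord.
  by rewrite -mulr_natl subn1 natz.
(* The inequality amounts to 2b <= 2^m (2b - |D|). Here 2b - |D| is at most (m - 1)Q + mP + 3m,
   while 2b is about PQ with P > 2^m m, which is a contradiction. *)
have b2 : (2 * b + Q = m * P + P * Q + m * Q + 2 * m)%N.
  have [P' PE] : exists P', P = P'.*2.+1 by exists P./2; lia.
  have [Q' QE] : exists Q', Q = Q'.*2.+1 by exists Q./2; lia.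
  have P2 : P./2 = P' by lia.
  have P12 : P.+1./2 = P'.+1 by lia.
  have Q12 : Q.+1./2 = Q'.+1 by lia.
  by rewrite /b /A P2 P12 Q12 PE QE; lia.
have M_gt0 : (0 < 2 ^ m)%N by rewrite expn_gt0.
have PQ : ((2 ^ m * m).+1 * Q <= P * Q)%N by rewrite leq_mul2r ltP orbT.
move: b2 szD ltQ M_gt0 PQ; move: (2 ^ m)%N (size D) => M d.
move=> b2 szD ltQ M_gt0 PQ le_d.
have Md : (M * d + 2 * b <= M * (2 * b))%N.
  by case: M M_gt0 le_d {ltQ PQ} => // N _; rewrite subn1 /=; lia.
have Mq : (M * (P * Q) <= M * d + M * m)%N by rewrite -mulnDr leq_mul2l szD orbT.
have MB : (M * (2 * b) + M * Q = M * (m * P) + M * (P * Q) + M * (m * Q) + M * (2 * m))%N.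
  by rewrite -!mulnDr b2.
have QM : (Q <= M * Q)%N by rewrite leq_pmull.
move: b2 ltQ PQ Md Mq MB QM; clear; lia.
Qed.
End AuxiliaryPolynomial.

(** * Back-and-forth between countable graphs with property U *)

Section BackAndForth.

Definition partial_iso (G H : graph) (p : set (G * H)) : Prop :=
  finite_set p /\
  forall x x' y y', p (x, y) -> p (x', y') ->
    (x = x' <-> y = y') /\ (adj x x' <-> adj y y').

Definition converse (X Y : Type) (p : set (X * Y)) : set (Y * X) :=
  [set z | p (z.2, z.1)].

Lemma partial_iso_converse (G H : graph) (p : set (G * H)) :
  partial_iso p -> partial_iso (converse p).
Proof.
case=> p_fin pP; split; last first.
  by move=> y y' x x' /= pxy pxy'; have [-> ->] := pP _ _ _ _ pxy pxy'.
have -> : converse p = (fun z => (z.2, z.1)) @` p; last exact: finite_image.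
by apply/seteqP; split=> [[y x] pxy|_ [[x y] pxy <-]] //; exists (x, y).
Qed.

(** For [x] outside the domain, property U is applied to the images of its neighbours and of its
    non-neighbours. These are disjoint because [p] is injective. *)
Lemma partial_iso_extend (G H : graph) (p : set (G * H)) (x : G) :
  property_U H -> partial_iso p ->
  exists p', [/\ partial_iso p', p `<=` p' & exists y, p' (x, y)].
Proof.
move=> UH piso; have [p_fin pP] := piso.
have [[y pxy]|nx] := pselect (exists y, p (x, y)).
  by exists p; split=> //; exists y.
pose nbr := [set z | adj x z.1] : set (G * H).
have [] := UH (snd @` (p `&` nbr)) (snd @` (p `&` ~` nbr)).
- by apply: finite_image; apply: finite_setIl.
- by apply: finite_image; apply: finite_setIl.
- apply/seteqP; split=> // y [[[x1 y1] /= [p1 a1] <-] [[x2 y2] /= [p2 a2] E]].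
  by apply: a2; rewrite /nbr /=; have [/iffRL-> //] := pP _ _ _ _ p2 p1.
move=> y [ny ya yb]; exists (p `|` [set (x, y)]); split; first last.
- by exists y; right.
- by move=> z; left.
have new x' y' : p (x', y') -> [/\ x' <> x, y' <> y & adj x x' <-> adj y y'].
  move=> p'; split=> [E|E|]; first by apply: nx; exists y'; rewrite -E.
    apply: ny; rewrite -E; have [a|a] := pselect (adj x x'); [left|right];
    by exists (x', y').
  split=> [a|]; first by apply: ya; exists (x', y').
  by apply: contraPP => a; apply: yb; exists (x', y').
split; first by rewrite finite_setU; split.
have sym (K : graph) (u w : K) : adj u w <-> adj w u by split; apply: adj_sym.
move=> x1 x2 y1 y2 [p1|[-> ->]] [p2|[-> ->]].
- exact: pP p1 p2.
- have [nx1 ny1 E] := new _ _ p1; split; last by rewrite sym E sym.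
  by split.
- by have [nx2 ny2 E] := new _ _ p2; split=> //; split=> /esym.
- by split=> //; split=> /adj_irr.
Qed.

(** Stage n brings the vertices with code n into the domain and the range. The union of the
    resulting chain is the graph of an isomorphism. *)
Lemma back_and_forth (G H : graph) :
  countable [set: G] -> countable [set: H] -> property_U G -> property_U H ->
  graph_iso G H.
Proof.
move=> /countable_injP[cG cG_inj] /countable_injP[cH cH_inj] UG UH.
pose T := {p : set (G * H) | partial_iso p}.
have step (pn : T * nat) : exists q : T, [/\ sval pn.1 `<=` sval q,
    forall x, cG x = pn.2 -> exists y, sval q (x, y) &
    forall y, cH y = pn.2 -> exists x, sval q (x, y)].
  case: pn => -[p piso] n /=.
  have [p1 [p1iso pp1 p1x]] : exists p1, [/\ partial_iso p1, p `<=` p1 &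
      forall x, cG x = n -> exists y, p1 (x, y)].
    (* The codings are only injective, so n may be the code of no vertex. *)
    have [[x <-]|nx] := pselect (exists x, cG x = n).
      have [p1 [p1iso pp1 p1x]] := partial_iso_extend x UH piso.
      exists p1; split=> // x' /cG_inj E; rewrite E ?inE //.
    by exists p; split=> // x xn; case: nx; exists x.
  have [p2 [p2iso pp2 p2y]] : exists p2, [/\ partial_iso p2, p1 `<=` p2 &
      forall y, cH y = n -> exists x, p2 (x, y)].
    have [[y <-]|ny] := pselect (exists y, cH y = n); last first.
      by exists p1; split=> // y yn; case: ny; exists y.
    have [p2 [p2iso pp2 p2y]] := partial_iso_extend y UG (partial_iso_converse p1iso).
    exists (converse p2); split; first exact: partial_iso_converse.
      by move=> [x' y'] p1'; apply: (pp2 (y', x')).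
    by move=> y' /cH_inj E; rewrite E ?inE.
  exists (exist _ p2 p2iso); split=> //=.
  - exact: subset_trans pp2.
  - by move=> x /p1x[y]; exists y; apply: pp2.
have [next nextP] := choice step.
have piso0 : partial_iso (set0 : set (G * H)) by split.
pose p := fix p n := if n is n'.+1 then next (p n', n') else exist _ set0 piso0 : T.
have p_mono i j : (i <= j)%N -> sval (p i) `<=` sval (p j).
  move/subnK <-; elim: (j - i)%N => [|d IHd] //; rewrite addSn.
  by apply: subset_trans IHd _; have [] := nextP (p (d + i)%N, (d + i)%N).
have Rtot x : exists y, exists n, sval (p n) (x, y).
  have [_ /(_ x erefl)[y xy] _] := nextP (p (cG x), cG x).
  by exists y, (cG x).+1.
have Rsurj y : exists x, exists n, sval (p n) (x, y).
  have [_ _ /(_ y erefl)[x xy]] := nextP (p (cH y), cH y).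
  by exists x, (cH y).+1.
have Riso x x' y y' : (exists n, sval (p n) (x, y)) ->
    (exists n, sval (p n) (x', y')) -> (x = x' <-> y = y') /\ (adj x x' <-> adj y y').
  move=> [n xy] [n' xy']; have [_] := svalP (p (maxn n n')); apply.
    exact: p_mono (leq_maxl _ _) _ xy.
  exact: p_mono (leq_maxr _ _) _ xy'.
have [f fP] := choice Rtot; have [g gP] := choice Rsurj.
exists f => [|x x']; last by have [] := Riso _ _ _ _ (fP x) (fP x').
exists g => [x|y]; first by have [/iffRL->] := Riso _ _ _ _ (gP (f x)) (fP x).
by have [/iffLR->] := Riso _ _ _ _ (fP (g y)) (gP y).
Qed.

End BackAndForth.

(** * The field of the infinite Paley graph, and property U for that graph *)

Lemma infinite_set_unbounded (E : set nat) (b : nat) :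
  infinite_set E -> exists2 n, E n & (b <= n)%N.
Proof.
move=> E_inf; apply: contrapT => none; apply: E_inf.
apply: (@sub_finite_set _ _ `I_b) => // n En /=.
by rewrite ltnNge; apply/negP => le_bn; apply: none; exists n.
Qed.

Section PaleyField.
Variables (K : closedFieldType) (p : nat) (charK : p \in [pchar K]).
Let p_prime : prime p := pcharf_prime charK.

(** By [subfield_root] every subfield of order p^n contains the p^n fixed points, hence equals their
    set. Conversely, this set is such a subfield. *)
Lemma GFE n x : (0 < n)%N -> GF K (p ^ n) x <-> x ^+ (p ^ n) = x.
Proof.
move=> n_gt0; have [V [uV szV VE]] := frobenius_fixed_points charK n_gt0.
have q_gt0 : (0 < p ^ n)%N by rewrite expn_gt0 prime_gt0.
split=> [[F Fq Fx]|xq].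
  have [s [us szs sE]] := subfield_seq Fq.
  have subVs : {subset V <= s}.
    by move=> y; rewrite VE => /eqP yq; apply/sE/(subfield_root Fq).
  have [_ eqVs] := uniq_min_size uV subVs (eq_leq (etrans szs (esym szV))).
  by apply/eqP; rewrite -VE eqVs; apply/sE.
exists [set` V]; last by rewrite /= VE xq.
split.
  split=> [|y z|y z]; rewrite !in_setE /= !VE.
  - by rewrite expr1n.
  - by move=> /eqP yq /eqP zq; rewrite exprB_pchar // yq zq.
  - by move=> /eqP yq /eqP zq; rewrite expr_div_n yq zq.
apply/card_set_bijP; exists (fun y => index y V); split.
- by move=> y /= yV; rewrite -szV index_mem.
- by move=> y z; rewrite !in_setE /= => yV zV; apply: index_inj.
- move=> k /= kq; exists (nth 0 V k); first by rewrite mem_nth ?szV.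
  by rewrite index_uniq ?szV.
Qed.

Lemma exp_fixed_pow (x : K) q e : x ^+ q = x -> x ^+ (q ^ e) = x.
Proof. by move=> xq; elim: e => [|e IHe]; rewrite ?expr1 // expnS exprM xq. Qed.

Lemma exp_negated_pow (x : K) q e :
  odd q -> odd e -> x ^+ q = - x -> x ^+ (q ^ e) = - x.
Proof.
move=> q_odd e_odd xq; suff -> : x ^+ (q ^ e) = (-1) ^+ e * x.
  by rewrite -signr_odd e_odd mulN1r.
elim: e {e_odd} => [|e IHe]; first by rewrite expr1 mul1r.
rewrite expnSr exprM IHe exprMn xq -exprM mulnC exprM.
by rewrite -[(-1) ^+ q]signr_odd q_odd expr1 exprSr mulrN1 mulNr mulrN.
Qed.

Hypothesis p_odd : odd p.

Lemma oppr_fixed_eq0 (x : K) : - x = x -> x = 0.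
Proof.
move=> /eqP; rewrite eq_sym -addr_eq0 -mulr2n -mulr_natr mulf_eq0.
rewrite -(dvdn_pcharf charK) dvdn_prime2 // => /orP[/eqP //|/eqP p2].
by move: p_odd; rewrite p2.
Qed.

Variable E : set nat.
Hypothesis E_infinite : infinite_set E.
Hypothesis E_odd : forall e, E e -> odd e.
Hypothesis E_lcm : forall d e, E d -> E e -> E (lcmn d e).

Let r := paley_r p.

Let r_gt0 : (0 < r)%N. Proof. by rewrite /r /paley_r; case: ifP. Qed.

Let E_gt0 e : E e -> (0 < r * e)%N.
Proof. by move=> /E_odd; rewrite muln_gt0 r_gt0; case: e. Qed.

Lemma dvdn_fixed (x : K) d e : (d %| e)%N ->
  x ^+ (p ^ (r * d)) = x -> x ^+ (p ^ (r * e)) = x.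
Proof. by move=> /dvdnP[k ->] xd; rewrite mulnCA mulnC expnM; apply: exp_fixed_pow. Qed.

(** Least common multiples put finitely many elements into one finite subfield. Starting from a
    large member of [E] makes that subfield as large as needed for [sign_pattern]. *)
Lemma GF_union_common (s : seq K) b : (forall x, x \in s -> GF_union K p r E x) ->
  exists2 n, E n /\ (b <= n)%N & forall x, x \in s -> x ^+ (p ^ (r * n)) = x.
Proof.
elim: s => [|x s IHs] sE.
  by have [n En le_bn] := infinite_set_unbounded b E_infinite; exists n.
have [|n [En le_bn] sn] := IHs; first by move=> y ys; apply: sE; rewrite inE ys orbT.
have [e Ee /(GFE _ (E_gt0 Ee)) xe] := sE x (mem_head _ _).
have Ene := E_lcm En Ee; exists (lcmn n e).
  split=> //; apply: leq_trans le_bn (dvdn_leq _ (dvdn_lcml _ _)).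
  by move: (E_odd Ene); case: lcmn.
move=> y; rewrite inE => /predU1P[->|/sn yn].
  exact: dvdn_fixed (dvdn_lcmr _ _) xe.
exact: dvdn_fixed (dvdn_lcml _ _) yn.
Qed.

Lemma GF_union_countable : countable (GF_union K p r E).
Proof.
apply: bigcup_countable => [|e Ee]; first exact: countableP.
apply: finite_set_countable.
have [V [_ _ VE]] := frobenius_fixed_points charK (E_gt0 Ee).
apply/finite_seqP; exists V; apply/seteqP.
split=> x /=; rewrite VE; first by move/(GFE _ (E_gt0 Ee)) ->.
by move/eqP/(GFE _ (E_gt0 Ee)).
Qed.

Lemma infinite_paley_countable : countable [set: infinite_paley K p_odd E].
Proof.
have /countable_injP[f f_inj] := GF_union_countable.
apply/countable_injP; exists (fun x => f (sval x)) => x y _ _ /f_inj E_xy.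
apply/val_inj/E_xy; apply/mem_set; exact: set_valP.
Qed.

Lemma infinite_paley_property_U : property_U (infinite_paley K p_odd E).
Proof.
move=> A B /finite_seqP[sA ->] /finite_seqP[sB ->] disj.
pose S := undup (map val (sA ++ sB)).
have SE x : x \in S -> GF_union K p r E x.
  by rewrite mem_undup => /mapP[y _ ->]; apply: set_valP.
(* As t < p^t, exponents at or above the thresholds of [sign_pattern] meet its conditions: P = p^i
   depends on m alone, and Q = p^k has k > c. *)
pose m := size S; pose i := (2 ^ m * m)%N.
pose c := (2 ^ m * (m * p ^ i + 3 * m))%N.
have [n [En le_n] Sn] := GF_union_common (i + c + 1) SE.
pose k := (r * n - i)%N.
have rnE : (r * n = i + k)%N.
  by rewrite subnKC // (leq_trans _ (leq_pmull _ r_gt0)) //; lia.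
have ck : (c < k)%N by have := leq_pmull n r_gt0; lia.
have p_gt1 : (1 < p)%N := prime_gt1 p_prime.
(* The sign -1 is prescribed exactly at the vertices of [B]. *)
pose eps (l : 'I_m) := tnth (in_tuple S) l \in map val sB.
have [|||||v [vq vS vE]] := @sign_pattern K p charK p_odd m i k (in_tuple S) eps.
- exact: leq_ltn_trans ck.
- exact: undup_uniq.
- by move=> l; rewrite -expnD -rnE Sn // mem_tnth.
- exact: ltn_expl.
- exact: ltn_trans ck (ltn_expl _ p_gt1).
rewrite -expnD -rnE in vq vE.
set q := (p ^ (r * n))%N in vq vE Sn.
have q_odd : odd q by rewrite oddX p_odd orbT.
have qE : (q = (2 * q./2).+1)%N by rewrite -[LHS]odd_double_half q_odd mul2n.
have vGF : GF K q v by apply/GFE => //; apply: E_gt0.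
have vU : v \in GF_union K p r E by apply/mem_set; exists n.
have sign_at (x : set_type (GF_union K p r E)) : x \in sA ++ sB ->
    (v - val x) ^+ q./2 = (-1) ^+ (val x \in map val sB).
  move=> xs; have /tnthP[l ->] : val x \in in_tuple S by rewrite mem_undup map_f.
  exact: vE.
(* Since z^q = z (z^2)^((q - 1)/2), the prescribed sign tells whether a square root z of v - x,
   taken in K, lies in F_q. *)
have sq_root (x : set_type (GF_union K p r E)) z :
    x \in sA ++ sB -> v - val x = z ^+ 2 -> z ^+ q = (-1) ^+ (val x \in map val sB) * z.
  by move=> xs vx; rewrite -sign_at // vx -exprM -exprSr -qE.
exists (SigSub vU); split.
- move=> vAB; move: vS => /negP; apply; rewrite mem_undup.
  apply/mapP; exists (SigSub vU); last by [].
  by rewrite mem_cat; apply/orP.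
- move=> a /= aA; exists n => //.
  have aS : a \in sA ++ sB by rewrite mem_cat aA.
  have aB : (val a \in map val sB) = false.
    apply/negP; rewrite (mem_map val_inj) => aB.
    by have : ([set` sA] `&` [set` sB]) a by []; rewrite disj.
  have /closed_rootP[z] : size ('X^2 - (v - val a)%:P) != 1%N.
    by rewrite size_XnsubC.
  rewrite /root !hornerE subr_eq0 => /eqP z2.
  have zq := sq_root a z aS (esym z2); rewrite aB mul1r in zq.
  split=> //.
    apply/GFE; first exact: E_gt0.
    by apply: Sn; rewrite mem_undup map_f.
  exists z => //; split; first by apply/GFE => //; apply: E_gt0.
  apply: contraNneq vS => z0; rewrite mem_undup.
  move: z2; rewrite z0 expr0n => /esym/eqP; rewrite subr_eq0 => /eqP->.
  by rewrite map_f.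
(* A square root z of v - b has z^q = -z, hence z^(q^e) = -z as e is odd, so z
   cannot be fixed by x |-> x^(p^(r e)), a power of which is x |-> x^(q^e). *)
- move=> b /= bB [e Ee [_ _ [z [/(GFE _ (E_gt0 Ee)) ze z0] vb]]].
  have bS : b \in sA ++ sB by rewrite mem_cat bB orbT.
  have zq := sq_root b z bS vb; rewrite map_f // mulN1r in zq.
  case/eqP: z0; apply: oppr_fixed_eq0.
  rewrite -(exp_negated_pow q_odd (E_odd Ee) zq) /q -expnM mulnAC expnM.
  exact: exp_fixed_pow.
Qed.

End PaleyField.

(** Both graphs are countable with property U, so back-and-forth applies; [iota] supplies the
    characteristic of [K]. *)
Theorem theorem3p1 (p : nat) (p_prime : prime p) (p_odd : odd p)
    (K : closedFieldType) (iota : {rmorphism 'F_p -> K})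
    (K_algebraic : forall x : K, algebraicOver iota x)
    (E : set nat) (E_infinite : infinite_set E)
    (E_odd : forall e, E e -> odd e)
    (E_div : forall d e, E e -> (d %| e)%N -> E d)
    (E_lcm : forall d e, E d -> E e -> E (lcmn d e))
    (R : graph) (R_random : countable_random_graph R) :
  graph_iso (infinite_paley K p_odd E) R.
Proof.
have charK : p \in [pchar K] by apply: (rmorph_pchar iota); apply: pchar_Fp.
have [R_card R_U] := R_random.
apply: back_and_forth => //.
- exact: infinite_paley_countable charK _ _ E_odd.
- by move: R_card; rewrite card_eq_le => /andP[].
- exact: infinite_paley_property_U.
Qed.
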